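(* Let $B=B_\Gamma$ be the skew-symmetric matrix of an ideal triangulation $\Gamma$ of a once-punctured surface $(S,P)$. Then $B$ does not have reddening or maximal green sequences; that is, no mutation sequence of the form $(B,m,\sigma)$ is reddening, and none is maximal green.
   Context: Surfaces. $S$ is a closed oriented surface and $P$ is a one-point subset of $S$ (the puncture); $(S,P)$ is then called a once-punctured surface. An ideal triangulation $\Gamma$ of $(S,P)$ is a triangulation of $S$ (in the generalized sense: edges may be loops and triangles may have identified vertices or share several edges) whose vertices are the points of $P$; it is assumed to have no self-folded edges, i.e. no triangle has two of its sides glued to each other to enclose a puncture (this holds for every ideal triangulation of a once-punctured closed surface). Label the edges of $\Gamma$ by $1,\dots,n$. For a triangle $t$ of $\Gamma$ let $B^t$ be the $n\times n$ matrix with $B^t_{ij}=1$ if $t$ has sides $i$ and $j$ and the direction from $i$ to $j$ is clockwise, $B^t_{ij}=-1$ if the same holds with counter-clockwise, and $B^t_{ij}=0$ otherwise. Put $B_\Gamma=\sum_t B^t$, the sum over all triangles $t$ of $\Gamma$; it is a skew-symmetric integer matrix. Mutations of matrices. For a skew-symmetric $n\times n$ integer matrix $B$ and $k\in\{1,\dots,n\}$, $\mu_k(B)=\widetilde B$ where $\widetilde B_{ij}=-B_{ij}$ if $i=k$ or $j=k$; otherwise $\widetilde B_{ij}=B_{ij}+B_{ik}B_{kj}$ if $B_{ik}>0$ and $B_{kj}>0$, $\widetilde B_{ij}=B_{ij}-B_{ik}B_{kj}$ if $B_{ik}<0$ and $B_{kj}<0$, and $\widetilde B_{ij}=B_{ij}$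 in the remaining cases. Tropical Y-seeds. Let $\mathcal F_{\mathrm{trop}}$ be the set of Laurent monomials in $y_1,\dots,y_n$ with the usual multiplication and the addition $\prod_i y_i^{a_i}\oplus\prod_i y_i^{b_i}=\prod_i y_i^{\min(a_i,b_i)}$. For $Y\in\mathcal F_{\mathrm{trop}}^n$, the mutation is $\mu_k(B,Y)=(\mu_k(B),\widetilde Y)$ with $\widetilde Y_k=Y_k^{-1}$ and, for $i\ne k$, $\widetilde Y_i=Y_i(Y_k^{-1}\oplus1)^{-B_{ki}}$ if $B_{ki}\ge0$ and $\widetilde Y_i=Y_i(Y_k\oplus1)^{-B_{ki}}$ if $B_{ki}\le0$. A permutation $\sigma$ acts by $\sigma(B)_{ij}=B_{\sigma^{-1}(i)\sigma^{-1}(j)}$, $\sigma(Y)_i=Y_{\sigma^{-1}(i)}$. A mutation sequence is a triple $\gamma=(B,m,\sigma)$ with $m=(m_1,\dots,m_T)$ a sequence in $\{1,\dots,n\}$ and $\sigma=(\sigma_1,\dots,\sigma_T)$ a sequence of permutations of $\{1,\dots,n\}$. Put $(B(0),Y(0))=(B,(y_1,\dots,y_n))$ and $(B(t),Y(t))=\sigma_t(\mu_{m_t}(B(t-1),Y(t-1)))$ for $1\le t\le T$, computed in $\mathcal F_{\mathrm{trop}}$. Define integers $c_{ij}(t)$ by $Y_j(t)=y_1^{c_{1j}(t)}\cdots y_n^{c_{nj}(t)}$; the $C$-matrix is $C(t)=(c_{ij}(t))_{1\le i,j\le n}$ and its columns $\mathbf c_j(t)$ are the $\mathbf c$-vectors.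 By the known sign-coherence theorem, each $\mathbf c_j(t)$ is non-zero with entries either all non-negative or all non-positive; let $\varepsilon_t\in\{+,-\}$ be the sign of $\mathbf c_{m_t}(t-1)$. The mutation sequence $\gamma$ is reddening if all entries of $C(T)$ are non-positive, and maximal green if it is reddening and $\varepsilon_t=+$ for all $t=1,\dots,T$. *)

(* Defs.v *)
From HB Require Import structures.
From mathcomp Require Import all_boot all_order all_algebra all_fingroup.

Set Implicit Arguments.
Unset Strict Implicit.
Unset Printing Implicit Defensive.

Import Order.TTheory GRing.Theory Num.Theory.
Local Open Scope ring_scope.

(** * Ideal triangulations *)

(* A triangulation of a closed oriented surface is given by the gluing of its
   oriented triangles: [side t s], for [s] in the cyclic order 0, 1, 2, lists
   the labels of the edges that form the boundary of [t], clockwise.  The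
   surface is closed, so every edge is a side of triangles exactly twice; since
   the surface is oriented, the two sides carrying the same label are glued in
   the unique orientation-compatible way, so the labels determine the gluing.
   In an oriented gluing, two sides of one triangle that are glued to each other
   always fold around the vertex between them, so that excluding self-folded
   edges amounts to the injectivity of [side t]. *)
Record ideal_triangulation (n : nat) := IdealTriangulation {
  triangle : finType;
  side : triangle -> 'I_3 -> 'I_n;
  edge_has_two_sides :
    forall e : 'I_n, #|[set d : triangle * 'I_3 | side d.1 d.2 == e]| = 2%N;
  no_self_folded_edge : forall t : triangle, injective (side t)
}.

(* Corner [(t, s)] is the origin of the side [s] of [t] when the boundary of [t]
   is traversed clockwise; the endpoint of that side is [(t, ordS s)].  Two
   distinct sides with the same label are glued with opposite directions: the
   origin of each one is identified with the endpoint of the other. *)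
Definition corner_glued n (G : ideal_triangulation n)
    (c c' : triangle G * 'I_3) : bool :=
  [exists d : triangle G * 'I_3, exists d' : triangle G * 'I_3,
    [&& d != d', side d.1 d.2 == side d'.1 d'.2 &
        ((c == d) && (c' == (d'.1, ordS d'.2))) ||
        ((c == (d.1, ordS d.2)) && (c' == d'))]].

(* The vertices are the classes of corners under the equivalence relation
   generated by [corner_glued]. *)
Definition number_of_vertices n (G : ideal_triangulation n) : nat :=
  n_comp (@corner_glued n G) [pred c : triangle G * 'I_3 | true].

(* The condition forces the surface to be nonempty and connected, because every
   component has at least one vertex. *)
Definition once_punctured n (G : ideal_triangulation n) : Prop :=
  number_of_vertices G = 1%N.

Definition clockwise n (G : ideal_triangulation n) (t : triangle G)
    (i j : 'I_n) : bool :=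
  [exists s : 'I_3, (side t s == i) && (side t (ordS s) == j)].

Definition triangle_matrix n (G : ideal_triangulation n) (t : triangle G)
    : 'M[int]_n :=
  \matrix_(i, j) if clockwise t i j then 1
                 else if clockwise t j i then -1
                 else 0.

Definition triangulation_matrix n (G : ideal_triangulation n) : 'M[int]_n :=
  \sum_(t : triangle G) triangle_matrix t.

(** * Matrix mutation *)

Definition mutate_matrix n (k : 'I_n) (B : 'M[int]_n) : 'M[int]_n :=
  \matrix_(i, j)
    if (i == k) || (j == k) then - B i j
    else if (0 < B i k) && (0 < B k j) then B i j + B i k * B k j
    else if (B i k < 0) && (B k j < 0) then B i j - B i k * B k j
    else B i j.

(** * Tropical semifield and Y-seeds *)

(* A Laurent monomial is represented by its exponents: [a] stands for the
   product of the [y_i ^ (a i)], so products are sums of exponents. *)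
Definition monomial (n : nat) : Type := {ffun 'I_n -> int}.

Definition trop_one n : monomial n := [ffun=> 0].
Definition trop_var n (j : 'I_n) : monomial n := [ffun i => (i == j)%:Z].
Definition trop_mul n (a b : monomial n) : monomial n :=
  [ffun i => a i + b i].
Definition trop_exp n (a : monomial n) (z : int) : monomial n :=
  [ffun i => z * a i].
Definition trop_inv n (a : monomial n) : monomial n := trop_exp a (-1).
Definition trop_add n (a b : monomial n) : monomial n :=
  [ffun i => Num.min (a i) (b i)].

Definition Yseed (n : nat) : Type := ('M[int]_n * {ffun 'I_n -> monomial n})%type.

Definition mutate_Y n (k : 'I_n) (B : 'M[int]_n)
    (Y : {ffun 'I_n -> monomial n}) : {ffun 'I_n -> monomial n} :=
  [ffun i =>
    if i == k then trop_inv (Y k)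
    else if 0 <= B k i then
      trop_mul (Y i)
        (trop_exp (trop_add (trop_inv (Y k)) (trop_one n)) (- B k i))
    else
      trop_mul (Y i) (trop_exp (trop_add (Y k) (trop_one n)) (- B k i))].

Definition mutate_seed n (k : 'I_n) (S : Yseed n) : Yseed n :=
  (mutate_matrix k S.1, mutate_Y k S.1 S.2).

Definition permute_seed n (s : 'S_n) (S : Yseed n) : Yseed n :=
  (\matrix_(i, j) S.1 ((s^-1)%g i) ((s^-1)%g j), [ffun i => S.2 ((s^-1)%g i)]).

(** * Mutation sequences *)

Record mutation_sequence (n : nat) := MutationSequence {
  initial_matrix : 'M[int]_n;
  seq_length : nat;
  directions : seq_length.-tuple 'I_n;
  permutations : seq_length.-tuple 'S_n
}.

Definition mutation_step n (S : Yseed n) (p : 'I_n * 'S_n) : Yseed n :=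
  permute_seed p.2 (mutate_seed p.1 S).

Definition seed_at n (g : mutation_sequence n) (t : nat) : Yseed n :=
  foldl (@mutation_step n) (initial_matrix g, [ffun j => trop_var j])
    (take t (zip (directions g) (permutations g))).

Definition C_matrix n (g : mutation_sequence n) (t : nat) : 'M[int]_n :=
  \matrix_(i, j) (seed_at g t).2 j i.

Definition c_vector n (g : mutation_sequence n) (j : 'I_n) (t : nat)
    : 'cV[int]_n :=
  col j (C_matrix g t).

(* The value 0 is a dummy for vectors that are zero or not sign-coherent. *)
Definition vector_sign n (v : 'cV[int]_n) : int :=
  if v == 0 then 0
  else if [forall i, 0 <= v i 0] then 1
  else if [forall i, v i 0 <= 0] then -1
  else 0.

(* [t] is counted from 0: [tropical_sign g t] is the sign of the mutation that
   leads from the seed at time [t] to the seed at time [t.+1]. *)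
Definition tropical_sign n (g : mutation_sequence n) (t : 'I_(seq_length g))
    : int :=
  vector_sign (c_vector g (tnth (directions g) t) t).

Definition reddening n (g : mutation_sequence n) : Prop :=
  forall i j : 'I_n, C_matrix g (seq_length g) i j <= 0.

Definition maximal_green n (g : mutation_sequence n) : Prop :=
  reddening g /\ forall t : 'I_(seq_length g), tropical_sign t = 1.

(* Main.v *)
Require Import Defs.
From mathcomp Require Import all_boot all_order all_algebra all_fingroup.
From mathcomp Require Import zify ring.

(* Every c-matrix has row sums 1, hence is never non-positive.  Indeed, the
   matrix stays that of a one-vertex triangulation, since mutation is a flip.
   The unique vertex does not have degree 2, so no arrows cancel, and every edge
   [k] has [sum_i [B_ki]_+ = sum_i [-B_ki]_+ = 2]; therefore a mutation at [k]
   preserves the product of all the Y-variables, whose square is the holonomy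
   around the puncture. *)

Set Implicit Arguments.
Unset Strict Implicit.
Unset Printing Implicit Defensive.

Import Order.TTheory GRing.Theory Num.Theory.
Local Open Scope ring_scope.

(* An element of [D] is a side of a triangle.  [alpha] exchanges the two sides
   glued to one edge and [phi] goes to the next side of the triangle, so that
   [phi \o alpha] rotates around the origin of a side: its orbits are the
   vertices, and [vertex_unique] says that there is at most one. *)
Record one_vertex_gluing (D : finType) n (e : D -> 'I_n) (alpha phi : D -> D)
    : Prop := OneVertexGluing {
  opposite_involutive : involutive alpha;
  opposite_neq : forall x, alpha x != x;
  eq_edge : forall x y, (e x == e y) = (x == y) || (x == alpha y);
  edge_onto : forall k, exists x, e x = k;
  next_cycle3 : forall x, phi (phi (phi x)) = x;
  edge_next_neq : forall x, e (phi x) != e x;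
  vertex_unique : forall P : pred D,
    (forall x, P (phi (alpha x)) = P x) -> forall x y, P x = P y
}.

(** Arrows of the quiver before 2-cycles are cancelled. *)
Definition arrows (D : finType) n (e : D -> 'I_n) (phi : D -> D) (i j : 'I_n)
    : int :=
  \sum_(x : D) ((e x == i) && (e (phi x) == j))%:Z.

Definition gluing_matrix (D : finType) n (e : D -> 'I_n) (phi : D -> D)
    : 'M[int]_n :=
  \matrix_(i, j) (arrows e phi i j - arrows e phi j i).

(** * Sums over a finite type *)

Lemma sum_support2 (T : finType) (F : T -> int) (x y : T) :
  x != y -> (forall z, z != x -> z != y -> F z = 0) ->
  \sum_z F z = F x + F y.
Proof.
move=> xy F0; rewrite (bigD1 x) // (bigD1 y) 1?eq_sym //= addrA big1 ?addr0 //.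
by move=> z /andP[zx zy]; apply: F0.
Qed.

(** Used for flips: they change [phi] on six sides only, so an arrow count changes by six explicit
    differences. *)
Lemma sum_next_update (T : finType) (s : seq T) (phi phi' : T -> T)
    (F : T -> T -> int) :
  uniq s -> (forall x, x \notin s -> phi' x = phi x) ->
  \sum_x F x (phi' x) =
    \sum_x F x (phi x) + \sum_(x <- s) (F x (phi' x) - F x (phi x)).
Proof.
move=> us eq_out; apply/eqP; rewrite addrC -subr_eq -sumrB.
rewrite (bigID (mem s)) /= [X in _ + X]big1 ?addr0 ?big_uniq // => x xs.
by rewrite eq_out // subrr.
Qed.

(** * Arrows and degrees in a one-vertex gluing *)

Section Gluing.

Variables (D : finType) (n : nat) (e : D -> 'I_n) (alpha phi : D -> D).
Hypothesis glue : one_vertex_gluing e alpha phi.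

Let alphaK := opposite_involutive glue.
Let alphaN := opposite_neq glue.
Let eqe := eq_edge glue.
Let phi3 := next_cycle3 glue.
Let efold := edge_next_neq glue.

Lemma edge_opposite x : e (alpha x) = e x.
Proof. by apply/eqP; rewrite eqe eqxx orbT. Qed.

Lemma next_inj : injective phi.
Proof. by move=> x y /(congr1 (phi \o phi)) /=; rewrite !phi3. Qed.

(* Otherwise the two edges would bound a vertex of degree 2, whereas the unique
   vertex meets all three corners of some triangle. *)
Lemma no_opposite_arrows x y : e (phi x) = e y -> e (phi y) != e x.
Proof.
move=> xy; apply/eqP => yx.
(* If [y] followed [x] in its triangle, the third side would lie on the edge of [x]. *)
have xy' : phi x = alpha y.
  move/eqP: xy; rewrite eqe => /orP[/eqP xy|/eqP //].
  have := efold (phi y); rewrite -{1}xy phi3 -yx eqxx //.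
have yx' : phi y = alpha x.
  move/eqP: yx; rewrite eqe => /orP[/eqP yx|/eqP //].
  have := efold (phi x); rewrite -{1}yx phi3 xy eqxx //.
have nx : phi (alpha (phi x)) = phi y by rewrite xy' alphaK.
have ny : phi (alpha (phi y)) = phi x by rewrite yx' alphaK.
(* Rotation swaps [phi x] and [phi y], so these two sides form a whole vertex, hence all of [D]. *)
pose P : pred D := [pred z | (z == phi x) || (z == phi y)].
have PE z : (z == phi x) || (z == phi y).
  suff : P z = P (phi x) by rewrite /P /= eqxx => ->.
  apply: (vertex_unique glue) => {}z.
  have inj : injective (phi \o alpha).
    exact: inj_comp next_inj (inv_inj alphaK).
  by rewrite /P /= -{1}ny -{2}nx !(inj_eq inj) orbC.
have dist z : phi z != z by apply: contraNneq (efold z) => ->.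
(* The other two sides of the triangle of [x] would both have to be [phi y]. *)
have [/= P1 P2] := (PE x, PE (phi (phi x))); move: P1 P2.
rewrite [x == _]eq_sym (negPf (dist x)) (negPf (dist (phi x))) /=.
move=> /eqP xE /eqP; rewrite -xE => /(congr1 phi); rewrite phi3 => xE'.
by move: (dist x); rewrite -xE' eqxx.
Qed.

Lemma arrows_ge0 i j : 0 <= arrows e phi i j.
Proof. by apply: sumr_ge0 => x _; case: (_ && _). Qed.

Lemma arrows_gt0 i j :
  0 < arrows e phi i j -> exists2 x, e x = i & e (phi x) = j.
Proof.
move=> pos; have [x /andP[/eqP xi /eqP xj]|none] :=
  pickP [pred x | (e x == i) && (e (phi x) == j)].
  by exists x.
by move: pos; rewrite /arrows big1 ?ltxx // => x _; have /= -> := none x.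
Qed.

Lemma arrows_disjoint i j :
  arrows e phi i j = 0 \/ arrows e phi j i = 0.
Proof.
have := arrows_ge0 i j; rewrite le_eqVlt => /orP[/eqP <-|]; first by left.
move=> /arrows_gt0[x xi xj]; right.
have := arrows_ge0 j i; rewrite le_eqVlt => /orP[/eqP <- //|].
move=> /arrows_gt0[y yj yi].
by have := @no_opposite_arrows x y; rewrite xj yj yi xi eqxx => /(_ erefl).
Qed.

Section Edge.

Variables (d : D) (k : 'I_n).
Hypothesis dk : e d = k.

Lemma arrows_from j :
  arrows e phi k j = (e (phi d) == j)%:Z + (e (phi (alpha d)) == j)%:Z.
Proof.
rewrite /arrows (@sum_support2 _ _ d (alpha d)) 1?eq_sym ?alphaN //.
  by rewrite edge_opposite dk eqxx.
by move=> z zd zd'; rewrite -dk eqe (negPf zd) (negPf zd').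
Qed.

Lemma arrows_to i :
  arrows e phi i k =
    (e (phi (phi d)) == i)%:Z + (e (phi (phi (alpha d))) == i)%:Z.
Proof.
rewrite /arrows (@sum_support2 _ _ (phi (phi d)) (phi (phi (alpha d)))).
- by rewrite !phi3 edge_opposite dk eqxx !andbT.
- by rewrite !(inj_eq next_inj) eq_sym alphaN.
move=> z zd zd'; rewrite -dk eqe.
rewrite -(inj_eq next_inj) -(inj_eq next_inj) phi3.
rewrite -[X in _ || X](inj_eq next_inj) -[X in _ || X](inj_eq next_inj) phi3.
by rewrite (negPf zd) (negPf zd') andbF.
Qed.

End Edge.

Lemma sum_indicator (x : 'I_n) : \sum_i (x == i)%:Z = 1 :> int.
Proof.
rewrite (bigD1 x) //= eqxx big1 ?addr0 // => i ix.
by rewrite eq_sym (negPf ix).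
Qed.

(** By [arrows_disjoint] nothing cancels, so positive parts of entries count arrows; each of the two
    sides of [k] has exactly one successor. *)
Lemma outdegree k : \sum_i Num.max (gluing_matrix e phi k i) 0 = 2.
Proof.
have [d dk] := edge_onto glue k.
transitivity (\sum_i arrows e phi k i).
  apply: eq_bigr => i _; rewrite mxE.
  have := arrows_ge0 k i; have := arrows_ge0 i k.
  by case: (arrows_disjoint k i) => ->; lia.
under eq_bigr do rewrite (arrows_from dk).
by rewrite big_split /= !sum_indicator.
Qed.

Lemma indegree k : \sum_i Num.max (- gluing_matrix e phi k i) 0 = 2.
Proof.
have [d dk] := edge_onto glue k.
transitivity (\sum_i arrows e phi i k).
  apply: eq_bigr => i _; rewrite mxE.
  have := arrows_ge0 k i; have := arrows_ge0 i k.
  by case: (arrows_disjoint k i) => ->; lia.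
under eq_bigr do rewrite (arrows_to dk).
by rewrite big_split /= !sum_indicator.
Qed.

(** * Flips of an edge *)

Section Flip.

Variable d : D.

Local Notation d' := (alpha d).
Local Notation a := (phi d).
Local Notation b := (phi (phi d)).
Local Notation c := (phi (alpha d)).
Local Notation f := (phi (phi (alpha d))).

(* The triangles [(d, a, b)] and [(d', c, f)] are replaced by [(d, b, c)] and
   [(d', f, a)]. *)
Definition flip : D -> D :=
  [fun x => phi x with d |-> b, b |-> c, c |-> d, d' |-> f, f |-> a, a |-> d'].

Let quad := [:: d; a; b; d'; c; f].

Let ea : e a != e d. Proof. exact: efold. Qed.
Let eb : e b != e d. Proof. by have := efold b; rewrite phi3 eq_sym. Qed.
Let ec : e c != e d. Proof. by rewrite -(edge_opposite d); apply: efold. Qed.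
Let ef : e f != e d.
Proof. by have := efold f; rewrite phi3 edge_opposite eq_sym. Qed.
Let eab : e a != e b. Proof. by rewrite eq_sym efold. Qed.
Let ecf : e c != e f. Proof. by rewrite eq_sym efold. Qed.
(** Neighbouring sides of the quadrilateral that meet at an end of the diagonal [d] lie on different
    edges, so the flip creates no self-folded edge. Opposite sides ([a] and [c], or [b] and [f]) may
    share an edge, as in the torus. *)
Let ecb : e c != e b.
Proof. by apply: no_opposite_arrows; rewrite phi3 edge_opposite. Qed.
Let eaf : e a != e f.
Proof. by apply: no_opposite_arrows; rewrite phi3 edge_opposite. Qed.

Let neqe x y : e x != e y -> x != y.
Proof. by apply: contraNneq => ->. Qed.

Let dd' : d != d'. Proof. by rewrite eq_sym. Qed.
Let ac : a != c. Proof. by rewrite (inj_eq next_inj). Qed.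
Let bf : b != f. Proof. by rewrite !(inj_eq next_inj). Qed.
Let d'E x : e x != e d -> x != d'.
Proof. by rewrite -(edge_opposite d); apply: neqe. Qed.

Let quad_neq :
  (((d == a) = false) * ((d == b) = false) * ((d == d') = false)
  * ((d == c) = false) * ((d == f) = false) * ((a == b) = false)
  * ((a == d') = false) * ((a == c) = false) * ((a == f) = false)
  * ((b == d') = false) * ((b == c) = false) * ((b == f) = false)
  * ((d' == c) = false) * ((d' == f) = false) * ((c == f) = false))%type.
Proof.
by do !split; apply/negbTE; first [done | exact: neqe | exact: d'E
  | rewrite eq_sym; first [exact: neqe | exact: d'E]].
Qed.

Let quad_uniq : uniq quad.
Proof. by rewrite /= !inE !quad_neq. Qed.

Lemma flip_quad :
  ((flip d = b) * (flip b = c) * (flip c = d)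
   * (flip d' = f) * (flip f = a) * (flip a = d'))%type.
Proof.
rewrite /flip /=.
rewrite ![b == d]eq_sym ![c == d]eq_sym ![c == b]eq_sym ![d' == d]eq_sym.
rewrite ![d' == b]eq_sym ![f == d]eq_sym ![f == b]eq_sym ![f == c]eq_sym.
rewrite ![f == d']eq_sym ![a == d]eq_sym ![c == d']eq_sym !eqxx !quad_neq.
by [].
Qed.

Lemma flip_out x : x \notin quad -> flip x = phi x.
Proof.
rewrite !inE !negb_or => /and5P[xd xa xb xd' /andP[xc xf]].
rewrite /flip /= (negPf xd) (negPf xa) (negPf xb) (negPf xd') (negPf xc).
by rewrite (negPf xf).
Qed.

Lemma arrows_flip i j :
  arrows e flip i j = arrows e phi i j +
   (((e d == i) && (e b == j))%:Z + ((e b == i) && (e c == j))%:Z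
    + ((e c == i) && (e d == j))%:Z + ((e d == i) && (e f == j))%:Z
    + ((e f == i) && (e a == j))%:Z + ((e a == i) && (e d == j))%:Z)
  - (((e d == i) && (e a == j))%:Z + ((e a == i) && (e b == j))%:Z
    + ((e b == i) && (e d == j))%:Z + ((e d == i) && (e c == j))%:Z
    + ((e c == i) && (e f == j))%:Z + ((e f == i) && (e d == j))%:Z).
Proof.
rewrite /arrows (sum_next_update (fun x y => ((e x == i) && (e y == j))%:Z)
  quad_uniq flip_out) !big_cons big_nil !flip_quad !phi3 edge_opposite.
by ring.
Qed.

(** Edges with an arrow to [e d] are those of [b] and [f]; those with an arrow from it are those of
    [a] and [c]. Of the four paths through [e d], [b] to [c] and [f] to [a] become arrows after the
    flip, while [b] to [a] and [f] to [c] cancel the opposite arrows, which the flip removes. *)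
Lemma mutate_gluing_matrix :
  mutate_matrix (e d) (gluing_matrix e phi) = gluing_matrix e flip.
Proof.
apply/matrixP => i j; rewrite !mxE !arrows_flip.
rewrite !(arrows_from (erefl (e d))) !(arrows_to (erefl (e d))).
have [->|ik] := eqVneq i (e d) => /=.
  rewrite !(arrows_from (erefl (e d))) !(arrows_to (erefl (e d))).
  rewrite (negPf ea) (negPf eb) (negPf ec) (negPf ef) /= !andbF /= !andbT.
  by ring.
have [->|jk] := eqVneq j (e d) => /=.
  rewrite !(arrows_from (erefl (e d))) !(arrows_to (erefl (e d))).
  rewrite (negPf ea) (negPf eb) (negPf ec) (negPf ef) /= !andbF /= !andbT.
  by ring.
rewrite !andbF.
(* No edge is both a source and a target of arrows at [e d]; this decides the sign tests of the
   mutation. *)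
have sides z : ((e a == z) = false /\ (e c == z) = false)
    \/ ((e b == z) = false /\ (e f == z) = false).
  have [az|_] := eqVneq (e a) z.
    by right; rewrite -az ![_ == e a]eq_sym (negPf eab) (negPf eaf).
  have [cz|_] := eqVneq (e c) z; last by left.
  by right; rewrite -cz ![_ == e c]eq_sym (negPf ecb) (negPf ecf).
move: (arrows e phi i j) (arrows e phi j i) => u v.
have [[-> ->]|[-> ->]] := sides i; have [[-> ->]|[-> ->]] := sides j;
  do 4![case: (_ == _)]; rewrite /= ?addr0 ?add0r //; by ring.
Qed.

Lemma flip_gluing : one_vertex_gluing e alpha flip.
Proof.
split=> //; first exact: edge_onto glue.
- move=> x; have [|xq] := boolP (x \in quad).
    by rewrite !inE => /or4P[|||/or3P[]] /eqP ->; rewrite !flip_quad.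
  have q1 : phi x \notin quad.
    apply: contra xq; rewrite !inE.
    by case/or4P => [|||/or3P[]] /eqP /(congr1 (phi \o phi)) /=;
      rewrite !phi3 => ->; rewrite ?eqxx ?orbT.
  have q2 : phi (phi x) \notin quad.
    apply: contra xq; rewrite !inE.
    by case/or4P => [|||/or3P[]] /eqP /(congr1 phi) /=;
      rewrite !phi3 => ->; rewrite ?eqxx ?orbT.
  by rewrite (flip_out xq) (flip_out q1) flip_out.
- move=> x; have [|xq] := boolP (x \in quad); last by rewrite flip_out.
  rewrite !inE => /or4P[|||/or3P[]] /eqP ->;
    rewrite !flip_quad ?edge_opposite //; by rewrite eq_sym.
move=> P Pflip.
have Pf x y : flip (alpha x) = y -> P y = P x by move=> <-.
have Pb : P c = P (alpha b) by apply: Pf; rewrite alphaK flip_quad.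
have Pff : P a = P (alpha f) by apply: Pf; rewrite alphaK flip_quad.
have Pc : P d = P (alpha c) by apply: Pf; rewrite alphaK flip_quad.
have Pa : P d' = P (alpha a) by apply: Pf; rewrite alphaK flip_quad.
have Pd : P f = P d by apply: Pf; rewrite flip_quad.
have Pd' : P b = P d' by apply: Pf; rewrite alphaK flip_quad.
(* A predicate on sides depends here on their origins, and the flip moves only those of [d] and
   [d']. Their old origins are those of [c] and [a], so [Q] is invariant under the old rotation. *)
pose Q : pred D := fun x =>
  if x == d then P c else if x == d' then P a else P x.
have Qe x : e x != e d -> Q x = P x.
  by move=> xd; rewrite /Q (negPf (neqe xd)) (negPf (d'E xd)).
have Qd : Q d = P c by rewrite /Q eqxx.
have Qd' : Q d' = P a by rewrite /Q (negPf (alphaN d)) eqxx.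
have Qconst : forall x y, Q x = Q y.
  apply: (vertex_unique glue) => x; rewrite -[x in RHS]alphaK.
  move: (alpha x) => {}x; have [|xq] := boolP (x \in quad).
    rewrite !inE => /or4P[|||/or3P[]] /eqP ->;
      rewrite ?alphaK ?phi3 ?Qd ?Qd' ?[in RHS]Qe ?edge_opposite //;
      rewrite ?Qe //; congruence.
  have xd : e x != e d.
    apply: contraNneq xq => /eqP; rewrite eqe !inE => /orP[] -> //.
    by rewrite !orbT.
  have xd' : e (phi x) != e d.
    apply: contraNneq xq => /eqP; rewrite eqe !inE.
    by case/orP=> /eqP /(congr1 (phi \o phi)) /=; rewrite phi3 => ->;
      rewrite eqxx ?orbT.
  rewrite !Qe ?edge_opposite //; apply: Pf.
  by rewrite alphaK flip_out.
(* After the flip, [d] starts where [f] does and [d'] where [b] does. *)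
have PE x : P x = P f.
  have [->//|xd] := eqVneq x d.
  have [->|xd'] := eqVneq x d'.
    by rewrite -Pd' -!Qe.
  by rewrite -[RHS]Qe // -(Qconst x) /Q (negPf xd) (negPf xd').
by move=> x y; rewrite !PE.
Qed.

End Flip.

End Gluing.

(** * Relabelling, and the product of the Y-variables *)

Lemma relabel_gluing (D : finType) n (e : D -> 'I_n) (alpha phi : D -> D)
    (s : 'S_n) :
  one_vertex_gluing e alpha phi -> one_vertex_gluing (s \o e) alpha phi.
Proof.
case=> alphaK alphaN eqe onto phi3 efold vertex; split=> //=.
- by move=> x y; rewrite (inj_eq perm_inj).
- by move=> k; have [x xk] := onto ((s^-1)%g k); exists x; rewrite xk permKV.
by move=> x; rewrite (inj_eq perm_inj).
Qed.

Lemma relabel_gluing_matrix (D : finType) n (e : D -> 'I_n) (phi : D -> D)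
    (s : 'S_n) :
  \matrix_(i, j) gluing_matrix e phi ((s^-1)%g i) ((s^-1)%g j)
  = gluing_matrix (s \o e) phi.
Proof.
have E x i : (e x == (s^-1)%g i) = (s (e x) == i).
  by rewrite (can2_eq (permK s) (permKV s)).
apply/matrixP => i j; rewrite !mxE; congr (_ - _);
  by apply: eq_bigr => x _; rewrite !E.
Qed.

(* The logarithm of [Y_k^-2 * (Y_k^-1 + 1)^-2 * (Y_k + 1)^2 = 1]: with in- and
   outdegree 2, a mutation preserves the product of the Y-variables. *)
Lemma sum_mutate_Y n (k : 'I_n) (B : 'M[int]_n) (Y : {ffun 'I_n -> monomial n})
    (r : 'I_n) :
  B k k = 0 -> \sum_i Num.max (B k i) 0 = 2 ->
  \sum_i Num.max (- B k i) 0 = 2 ->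
  \sum_i mutate_Y k B Y i r = \sum_i Y i r.
Proof.
move=> Bkk outB inB; pose y := Y k r.
(* The last term accounts for the inversion of [Y k]; the two middle terms vanish at [k] because
   [B k k = 0]. *)
transitivity (\sum_i (Y i r - Num.max (B k i) 0 * Num.min (- y) 0
    + Num.max (- B k i) 0 * Num.min y 0 - (k == i)%:Z * (2 * y))).
  apply: eq_bigr => i _; rewrite ffunE eq_sym.
  have [<-|ki] := eqVneq k i.
    by rewrite Bkk !ffunE /y; lia.
  case: ifP => B0; rewrite !ffunE ?mulN1r -/y; last first.
    by rewrite [Num.max (B k i) 0]max_r ?[Num.max (- _) 0]max_l; lia.
  by rewrite [Num.max (B k i) 0]max_l ?[Num.max (- _) 0]max_r; lia.
rewrite sumrB big_split sumrB /= -!mulr_suml outB inB sum_indicator.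
(* The corrections cancel, as [min(y, 0) - min(-y, 0) = y]. *)
by move: (\sum_i _); case: (leP 0 y) => y0;
  [rewrite min_l ?min_r | rewrite min_r ?min_l]; lia.
Qed.

(** * The invariant of mutation sequences *)

Section MutationInvariant.

Variables (D : finType) (n : nat) (alpha : D -> D).

(** The sides and their pairing [alpha] stay fixed: a flip changes only [phi], a permutation only
    [e]. The second condition says that the rows of the C-matrix have sum 1. *)
Definition gluing_seed (S : Yseed n) : Prop :=
  (exists e phi, one_vertex_gluing e alpha phi /\ S.1 = gluing_matrix e phi)
  /\ forall r, \sum_j S.2 j r = 1.

Lemma mutation_step_gluing_seed S p :
  gluing_seed S -> gluing_seed (mutation_step S p).
Proof.
case: S p => [B Y] [k s] [[e [phi [glue /= ->]]] sumY] /=; split=> /=.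
  have [d dk] := edge_onto glue k.
  exists (s \o e), (flip alpha phi d); split.
    exact/relabel_gluing/flip_gluing.
  by rewrite -dk (mutate_gluing_matrix glue) relabel_gluing_matrix.
move=> r; rewrite -(sumY r) /=.
rewrite -(@sum_mutate_Y _ k (gluing_matrix e phi) Y r).
- rewrite (reindex_inj (@perm_inj _ s)) /=.
  by apply: eq_bigr => j _; rewrite ffunE permK.
- by rewrite mxE subrr.
- exact: outdegree glue k.
- exact: indegree glue k.
Qed.

Lemma foldl_gluing_seed S ps :
  gluing_seed S -> gluing_seed (foldl (@mutation_step n) S ps).
Proof.
by elim: ps S => //= p ps IH S HS; apply/IH/mutation_step_gluing_seed.
Qed.

End MutationInvariant.

(** * From ideal triangulations to one-vertex gluings *)

Section Triangulation.

Variables (n : nat) (G : ideal_triangulation n).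

Local Notation dart := (triangle G * 'I_3)%type.

Definition dart_edge (x : dart) : 'I_n := side x.1 x.2.
Definition dart_next (x : dart) : dart := (x.1, ordS x.2).
Definition dart_opposite (x : dart) : dart :=
  odflt x [pick y | (y != x) && (dart_edge y == dart_edge x)].

Lemma dart_edge_pair x :
  exists2 y, y != x & forall z,
    (dart_edge z == dart_edge x) = (z == x) || (z == y).
Proof.
have /eqP/cards2P[u [v [uv E]]] := edge_has_two_sides G (dart_edge x).
have edgeE z : (dart_edge z == dart_edge x) = (z == u) || (z == v).
  by have := in_set2 z u v; rewrite -E inE.
have := edgeE x; rewrite eqxx => /esym /orP[] /eqP xE; subst x.
  by exists v; rewrite 1?eq_sym.
by exists u => // z; rewrite edgeE orbC.
Qed.

(** Each label has exactly two sides, so the [pick] finds the only other one. *)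
Lemma dart_oppositeP x :
  (dart_opposite x != x) * forall y,
    (dart_edge y == dart_edge x) = (y == x) || (y == dart_opposite x).
Proof.
have [y yx E] := dart_edge_pair x.
suff -> : dart_opposite x = y by [].
rewrite /dart_opposite; case: pickP => [z /andP[zx]|/(_ y)] /=.
  by rewrite E (negPf zx) => /eqP.
by rewrite E yx eqxx orbT.
Qed.

Lemma dart_edge_opposite x : dart_edge (dart_opposite x) = dart_edge x.
Proof. by apply/eqP; rewrite dart_oppositeP eqxx orbT. Qed.

Lemma dart_opposite_involutive : involutive dart_opposite.
Proof.
move=> x; have : dart_edge x == dart_edge (dart_opposite x).
  by rewrite dart_edge_opposite.
rewrite dart_oppositeP => /orP[/eqP xE|/eqP //].
by have := dart_oppositeP x; rewrite -xE eqxx.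
Qed.

Lemma ordS3 (s : 'I_3) : ordS (ordS (ordS s)) = s.
Proof. by apply/val_inj; case: s => [[|[|[]]]]. Qed.

Lemma ordS_neq (s : 'I_3) : ordS s != s.
Proof. by case: s => [[|[|[]]]]. Qed.

Lemma dart_edge_next_neq x : dart_edge (dart_next x) != dart_edge x.
Proof.
by rewrite (inj_eq (@no_self_folded_edge _ G x.1)) /= ordS_neq.
Qed.

(** Identifying a corner with the side that starts there, gluing is one step of rotation around the
    vertex, in either direction; this links vertices to orbits of the rotation. *)
Lemma corner_gluedE c c' :
  corner_glued c c' =
    (c' == dart_next (dart_opposite c)) || (c == dart_next (dart_opposite c')).
Proof.
apply/existsP/idP => [[d /existsP[d' /and3P[dd' E]]]|].
  have {dd'} d'E : d' = dart_opposite d.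
    apply/eqP; move: ((dart_oppositeP d).2 d'); rewrite eq_sym /dart_edge E.
    by rewrite [d' == d]eq_sym (negPf dd').
  case/orP=> /andP[/eqP cE /eqP c'E]; subst; first by rewrite eqxx.
  by rewrite dart_opposite_involutive eqxx orbT.
have H x : [&& x != dart_opposite x &
    side x.1 x.2 == side (dart_opposite x).1 (dart_opposite x).2].
  have := dart_edge_opposite x; rewrite /dart_edge => ->.
  by rewrite eq_sym dart_oppositeP eqxx.
case/orP=> /eqP ->.
  exists c; apply/existsP; exists (dart_opposite c).
  by have /andP[-> ->] := H c; rewrite !eqxx.
exists (dart_opposite c'); apply/existsP; exists c'.
have /andP[] := H c'; rewrite eq_sym => -> /eqP ->.
by rewrite !eqxx orbT.
Qed.

Lemma triangulation_gluing :
  once_punctured G -> one_vertex_gluing dart_edge dart_opposite dart_next.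
Proof.
move=> HG; split.
- exact: dart_opposite_involutive.
- by move=> x; rewrite dart_oppositeP.
- by move=> x y; rewrite dart_oppositeP.
- move=> k; have /card_gt0P[x] : (0 < #|[set d : dart | side d.1 d.2 == k]|)%N.
    by rewrite edge_has_two_sides.
  by rewrite inE => /eqP; exists x.
- by case=> t s; rewrite /dart_next /= ordS3.
- exact: dart_edge_next_neq.
move=> P Pnext.
have sym : connect_sym (@corner_glued n G).
  by apply: sym_connect_sym => x y; rewrite !corner_gluedE orbC.
have closedP : closed (@corner_glued n G) P.
  move=> x y; rewrite corner_gluedE !unfold_in.
  by case/orP=> /eqP ->; rewrite Pnext.
(* [P] is constant on each vertex class, and there is only one root. *)
have Proot x : P x = P (fingraph.root (@corner_glued n G) x).
  exact: (closed_connect closedP (connect_root _ x)).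
move=> x y; rewrite Proot [RHS]Proot; congr (P _).
have /mem_card1[z zE] := HG.
have eqz u : fingraph.root (@corner_glued n G) u = z.
  by apply/eqP; rewrite -[_ == z]/(_ \in pred1 z) -zE !inE roots_root.
by rewrite !eqz.
Qed.

Lemma triangulation_matrixE :
  triangulation_matrix G = gluing_matrix dart_edge dart_next.
Proof.
apply/matrixP => i j; rewrite summxE mxE /arrows.
have pairE (F : triangle G -> 'I_3 -> int) :
    \sum_x F x.1 x.2 = \sum_t \sum_s F t s by rewrite pair_bigA.
rewrite -sumrB.
rewrite (pairE (fun t s => ((side t s == i) && (side t (ordS s) == j))%:Z
  - ((side t s == j) && (side t (ordS s) == i))%:Z)).
apply: eq_bigr => t _; rewrite mxE sumrB.
have inj := @no_self_folded_edge _ G t.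
(* The sides of a triangle have distinct labels, so at most one [s] contributes. *)
have cwE u v : \sum_s ((side t s == u) && (side t (ordS s) == v))%:Z
    = (clockwise t u v)%:Z :> int.
  have [/existsP[s /andP[/eqP su /eqP sv]]|none] := boolP (clockwise t u v).
    rewrite (bigD1 s) //= su sv !eqxx big1 // => s' s's.
    by rewrite -su (inj_eq inj) (negPf s's).
  rewrite big1 // => s _; case: andP => // suv; case/negP: none.
  by apply/existsP; exists s; apply/andP.
rewrite !cwE; case: ifP => [/existsP[s /andP[/eqP si /eqP sj]]|_]; last first.
  by case: ifP.
(* Both directions at once would give [ordS (ordS s) = s]. *)
have [/existsP[s' /andP[/eqP s'j]]|//] := boolP (clockwise t j i).
rewrite -si (inj_eq inj); move: s'j; rewrite -sj => /inj -> /eqP sE.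
by have := ordS_neq (ordS (ordS s)); rewrite ordS3 sE eqxx.
Qed.

End Triangulation.

Theorem theorem1p3 (n : nat) (G : ideal_triangulation n)
    (HG : once_punctured G) :
  (forall (T : nat) (m : T.-tuple 'I_n) (sigma : T.-tuple 'S_n),
     ~ reddening (MutationSequence (triangulation_matrix G) m sigma)) /\
  (forall (T : nat) (m : T.-tuple 'I_n) (sigma : T.-tuple 'S_n),
     ~ maximal_green (MutationSequence (triangulation_matrix G) m sigma)).
Proof.
suff not_red : forall (T : nat) (m : T.-tuple 'I_n) (sigma : T.-tuple 'S_n),
     ~ reddening (MutationSequence (triangulation_matrix G) m sigma).
  by split=> // T m sigma [/not_red].
move=> T m sigma red.
(* The vertex supplies a corner, whose edge selects a row of the C-matrix; with no rows, reddening
   would hold vacuously. *)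
have [x _] : exists x : triangle G * 'I_3, true.
  have /mem_card1[z _] := HG.
  by exists z.
have init : gluing_seed (@dart_opposite n G)
    (triangulation_matrix G, [ffun j => trop_var j]).
  split.
    exists (@dart_edge n G), (@dart_next n G); split.
      exact: triangulation_gluing.
    exact: triangulation_matrixE.
  move=> r; rewrite -[RHS](sum_indicator r).
  by apply: eq_bigr => j _; rewrite !ffunE.
set g := MutationSequence _ _ _ in red.
have [_ /(_ (dart_edge x)) sum1] :
  gluing_seed (@dart_opposite n G) (seed_at g T) by exact: foldl_gluing_seed.
suff : \sum_j (seed_at g T).2 j (dart_edge x) <= 0 by rewrite sum1.
by apply: sumr_le0 => j _; have := red (dart_edge x) j; rewrite mxE.
Qed.
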